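(* Let $(\mathcal{M},g)$ be a pseudo-Riemannian manifold of dimension $n>2$ with a concircularly semi-symmetric metric connection $\overset{1}{\nabla}$ with generator $P$ and scalar function $\omega$. Then $\overset{1}{\nabla}$ is a semi-symmetric metric $P$-connection if and only if $\omega=-g(P,P)$.
   Context: $\overset{g}{\nabla}$ denotes the Levi-Civita connection of $g$. Given a 1-form $\pi$ with associated vector field $P$, $\pi(\cdot)=g(\cdot,P)$, the semi-symmetric metric connection with generator $P$ is $\overset{1}{\nabla}_XY=\overset{g}{\nabla}_XY+\pi(Y)X-g(X,Y)P$. It is called a concircularly semi-symmetric metric connection if there is a scalar function $\omega$ with $(\overset{g}{\nabla}_X\pi)(Y)-\pi(X)\pi(Y)=\omega\, g(X,Y)$ for all vector fields $X,Y$. It is called a semi-symmetric metric $P$-connection if $\overset{1}{\nabla}P=0$, i.e. $\overset{1}{\nabla}_XP=0$ for all $X$. *)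

(* Defs.v *)
From HB Require Import structures.
From mathcomp Require Import all_boot all_order all_algebra.
From mathcomp Require Import all_classical all_reals all_analysis.
Set Implicit Arguments.
Unset Strict Implicit.
Unset Printing Implicit Defensive.
Import Order.TTheory GRing.Theory Num.Theory.
Import numFieldNormedType.Exports.
Local Open Scope classical_set_scope.
Local Open Scope ring_scope.

(* Meant for open A: limits and differentials are taken in the whole space. *)
Fixpoint Ck_on (R : realType) (n : nat) (W : normedModType R) (k : nat)
    (A : set 'rV[R]_n) (f : 'rV[R]_n -> W) : Prop :=
  match k with
  | 0 => forall x, A x -> {for x, continuous f}
  | k'.+1 => (forall x, A x -> differentiable f x) /\
             (forall v : 'rV[R]_n, Ck_on k' A ('D_v f))
  end.

Definition smooth_on (R : realType) (n : nat) (W : normedModType R)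
    (A : set 'rV[R]_n) (f : 'rV[R]_n -> W) : Prop :=
  forall k, Ck_on k A f.

(* [coord] and [coord_inv] are total; their values outside [dom] and outside
   [coord @` dom] carry no information. *)
Record chart (R : realType) (n : nat) (T : topologicalType) := Chart {
  dom : set T;
  coord : T -> 'rV[R]_n;
  coord_inv : 'rV[R]_n -> T;
  dom_open : open dom;
  codom_open : open (coord @` dom);
  coordK : forall p, dom p -> coord_inv (coord p) = p;
  coord_continuous : forall p, dom p -> {for p, continuous coord};
  coord_inv_continuous :
    forall x, (coord @` dom) x -> {for x, continuous coord_inv}
}.

(* A C^oo manifold of dimension [n], Hausdorff and second countable.  The map
   [chart_at] selects a chart around each point; it is used below to identify
   the tangent space at that point with R^n. *)
Record manifold (R : realType) (n : nat) := Manifold {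
  space :> topologicalType;
  manifold_hausdorff : hausdorff_space space;
  manifold_second_countable : @second_countable space;
  atlas : set (chart R n space);
  chart_at : space -> chart R n space;
  chart_at_atlas : forall p, atlas (chart_at p);
  chart_at_dom : forall p, dom (chart_at p) p;
  atlas_compatible : forall c d, atlas c -> atlas d ->
    smooth_on (coord c @` (dom c `&` dom d)) (coord d \o coord_inv c)
}.

Section Geometry.
Context (R : realType) (n : nat) (M : manifold R n).

(* A tangent vector at p is the row vector of its components in the chart
   [chart_at p]; the components in another chart d around p are obtained by
   multiplying on the right by [transition (chart_at p) d p].  Fields are
   given by their values in this sense, so they need not look continuous
   as maps on M: smoothness is always tested in a fixed chart. *)
Definition field := M -> 'rV[R]_n.

Definition transition (c d : chart R n M) (p : M) : 'M[R]_n :=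
  'J (coord d \o coord_inv c) (coord c p).

Definition field_in (c : chart R n M) (X : field) (p : M) : 'rV[R]_n :=
  X p *m transition (chart_at p) c p.

Definition smooth_map (W : normedModType R) (F : chart R n M -> M -> W) : Prop :=
  forall c, atlas c -> smooth_on (coord c @` dom c) (F c \o coord_inv c).

Definition smooth_function (f : M -> R) : Prop := smooth_map (fun=> f : M -> R^o).

Definition smooth_field (X : field) : Prop :=
  smooth_map (fun c => field_in c X).

Definition lie_derive (X : field) (f : M -> R) (p : M) : R :=
  'D_(X p) (f \o coord_inv (chart_at p) : 'rV[R]_n -> R^o)
    (coord (chart_at p) p).

(* In coordinates, [X, Y]^i = X^j d_j Y^i - Y^j d_j X^i. *)
Definition lie_bracket (X Y : field) : field := fun p =>
  let c := chart_at p in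
  'D_(X p) (field_in c Y \o coord_inv c) (coord c p)
  - 'D_(Y p) (field_in c X \o coord_inv c) (coord c p).

(* [g p] is the Gram matrix of the metric at p in the chart [chart_at p];
   [metric_in c g p] is the one in the chart c. *)
Definition metric := M -> 'M[R]_n.

Definition metric_in (c : chart R n M) (g : metric) (p : M) : 'M[R]_n :=
  let A := transition c (chart_at p) p in A *m g p *m A^T.

Definition pseudo_riemannian (g : metric) : Prop :=
  [/\ forall p, (g p)^T = g p,
      forall p, g p \in unitmx &
      forall i j, smooth_map (fun c p => metric_in c g p i j : R^o)].

Definition inner (g : metric) (X Y : field) (p : M) : R :=
  (X p *m g p *m (Y p)^T) 0 0.

(* Components of a 1-form, in the basis dual to that of [chart_at p]. *)
Definition one_form := M -> 'cV[R]_n.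

Definition pairing (a : one_form) (X : field) (p : M) : R := (X p *m a p) 0 0.

Definition flat (g : metric) (P : field) : one_form :=
  fun p => g p *m (P p)^T.

(* Only the values on smooth fields are meaningful. *)
Definition connection := field -> field -> field.

Definition is_connection (D : connection) : Prop :=
  [/\ forall X Y, smooth_field X -> smooth_field Y -> smooth_field (D X Y),
      forall f X X' Y, smooth_function f ->
        smooth_field X -> smooth_field X' -> smooth_field Y ->
        forall p, D (fun q => f q *: X q + X' q) Y p
                  = f p *: D X Y p + D X' Y p,
      forall X Y Y', smooth_field X -> smooth_field Y -> smooth_field Y' ->
        forall p, D X (fun q => Y q + Y' q) p = D X Y p + D X Y' p &
      forall f X Y, smooth_function f -> smooth_field X -> smooth_field Y ->
        forall p, D X (fun q => f q *: Y q) p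
                  = lie_derive X f p *: Y p + f p *: D X Y p].

Definition torsion_free (D : connection) : Prop :=
  forall X Y, smooth_field X -> smooth_field Y ->
  forall p, D X Y p - D Y X p = lie_bracket X Y p.

Definition metric_connection (g : metric) (D : connection) : Prop :=
  forall X Y Z, smooth_field X -> smooth_field Y -> smooth_field Z ->
  forall p, lie_derive X (inner g Y Z) p
            = inner g (D X Y) Z p + inner g Y (D X Z) p.

Definition levi_civita (g : metric) (D : connection) : Prop :=
  [/\ is_connection D, torsion_free D & metric_connection g D].

(* (D_X a)(Y) = X(a(Y)) - a(D_X Y) *)
Definition cov_derive (D : connection) (X : field) (a : one_form) (Y : field)
    (p : M) : R :=
  lie_derive X (pairing a Y) p - pairing a (D X Y) p.

Definition semi_symmetric (g : metric) (D : connection) (P : field) :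
    connection :=
  fun X Y p => D X Y p + pairing (flat g P) Y p *: X p - inner g X Y p *: P p.

(* The condition under which [semi_symmetric g D P], with D the Levi-Civita
   connection of g, is called concircular. *)
Definition concircular (g : metric) (D : connection) (P : field)
    (omega : M -> R) : Prop :=
  forall X Y, smooth_field X -> smooth_field Y ->
  forall p, cov_derive D X (flat g P) Y p
            - pairing (flat g P) X p * pairing (flat g P) Y p
            = omega p * inner g X Y p.

Definition P_connection (D : connection) (P : field) : Prop :=
  forall X, smooth_field X -> forall p, D X P p = 0.

End Geometry.

(* Main.v *)
From HB Require Import structures.
Require Import Defs.
From mathcomp Require Import all_boot all_order all_algebra.
From mathcomp Require Import all_classical all_reals all_analysis.
From mathcomp Require Import ring.
Set Implicit Arguments.
Unset Strict Implicit.
Unset Printing Implicit Defensive.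
Import Order.TTheory GRing.Theory Num.Theory.
Import numFieldNormedType.Exports.
Local Open Scope classical_set_scope.
Local Open Scope ring_scope.

(** Write D for the Levi-Civita connection and D1 for the semi-symmetric one.
    Since D is metric, (D_X pi)(Y) = g(D_X P, Y), so the concircular condition
    says that g(D_X P, Y) = pi(X) pi(Y) + omega g(X, Y).  In
    D1_X P = D_X P + g(P, P) X - g(X, P) P the last term cancels pi(X) pi(Y), and
    what is left is

      g(D1_X P, Y) = (omega + g(P, P)) g(X, Y)

    for all smooth X and Y ([inner_semi_symmetric]).  Both implications then
    follow from the nondegeneracy of g: if omega = - g(P, P) then D1_X P is
    orthogonal to everything; if D1 P = 0 and the factor did not vanish at p, then
    every smooth X would be orthogonal to everything at p, hence zero at p,
    although the tangent space is not trivial.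

    The analytic content is in the words everything and every.  The hypotheses
    speak of globally smooth fields only, and nondegeneracy at a point p is a
    statement about all tangent vectors at p, so every tangent vector has to be
    the value of a global smooth field ([exists_smooth_field]).  Such a field is
    a constant field in a chart around p, multiplied by a bump function with
    compact support in that chart and extended by zero.  Compactness and the
    Hausdorff property make the complement of the support open, which gives
    smoothness outside the chart; inside, smoothness in another chart comes from
    the chain rule ([transition_comp]) and from the stability of C^k functions
    under products and composition ([Ck_on_mul], [Ck_on_comp]).  The bump
    function itself is built from t |-> exp(- 1 / t) ([exists_bump]). *)

(** * Differentiability is a local property *)

Section DifferentiableLocal.
Context {R : realType} {V W : normedModType R}.

(** The differential is 0: the remainder vanishes near [x], so it is negligible. *)
Lemma differentiable_near0 (h : V -> W) (x : V) :
  (\forall y \near x, h y = 0) -> differentiable h x.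
Proof.
move=> h0.
have hx : h x = 0 := nbhs_singleton h0.
have ho : h \o shift x = cst (h x) + \0 +o_ 0 id.
  apply/eqaddoE/eqaddoP => e e0.
  move: h0; rewrite (near_shift 0) subr0; apply: filterS => y /= hy.
  rewrite hx !fctE /= hy addr0 subr0 normr0.
  by rewrite mulr_ge0// ltW.
have d0 : 'd h x = \0 :> (V -> W).
  by apply: (@diff_unique _ _ _ _ \0 x) => //; exact: cst_continuous.
by apply/diff_locallyP; rewrite d0; split => //; exact: cst_continuous.
Qed.

Lemma near_eq_differentiable (f g : V -> W) (x : V) :
  (\forall y \near x, f y = g y) -> differentiable f x -> differentiable g x.
Proof.
move=> fg df; have -> : g = f + (g - f) by rewrite addrC subrK.
apply: differentiableD => //; apply: differentiable_near0.
by apply: filterS fg => y fgy; rewrite !fctE fgy subrr.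
Qed.

End DifferentiableLocal.

Lemma derive_comp {R : realType} {U V W : normedModType R} (f : U -> V)
    (g : V -> W) (x v : U) :
  differentiable f x -> differentiable g (f x) ->
  'D_v (g \o f) x = 'D_('D_v f x) g (f x).
Proof.
move=> df dg; rewrite (deriveE v (differentiable_comp df dg)) (diff_comp df dg).
by rewrite (deriveE v df) (deriveE _ dg).
Qed.

(** * Stability properties of C^k functions *)

Section CkTheory.
Context {R : realType} {n : nat}.
Notation V := 'rV[R]_n.
Implicit Types (k : nat) (A B : set V).

(** Being C^k on a set is a condition at each of its points separately; this is
    what allows a field to be treated by different formulas near different points. *)
Lemma Ck_on_cover (W : normedModType R) k A (f : V -> W) :
  (forall x, A x -> exists2 B, B x & Ck_on k B f) -> Ck_on k A f.
Proof.
elim: k f => [|k IH] f /= fA; first by move=> x /fA[B Bx]; exact.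
split=> [x /fA[B Bx [df _]]|v]; first exact: df.
by apply: IH => x /fA[B Bx [_ Df]]; exists B.
Qed.

Lemma Ck_on_eq (W : normedModType R) k A (f g : V -> W) :
  open A -> (forall x, A x -> f x = g x) -> Ck_on k A f -> Ck_on k A g.
Proof.
move=> oA; have nearA (f' g' : V -> W) : (forall x, A x -> f' x = g' x) ->
    forall x, A x -> \forall y \near x, f' y = g' y.
  by move=> fg x Ax; apply: filterS (open_nbhs_nbhs (conj oA Ax)) => y /fg.
elim: k f g => [|k IH] f g fg /=.
  move=> cf x Ax; rewrite /prop_for /continuous_at -fg//.
  exact: cvg_trans (near_eq_cvg (nearA _ _ fg x Ax)) (cf x Ax).
move=> [df Df]; split=> [x Ax|v].
  by apply: near_eq_differentiable (df x Ax); exact: nearA fg x Ax.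
apply: IH (Df v) => x Ax.
by apply: near_eq_derive; exact: nearA fg x Ax.
Qed.

(** Inductive step for the stability lemmas: the derivatives of [f] need only be
    known on [A], which is where formulas such as the Leibniz rule hold. *)
Lemma Ck_onS (W : normedModType R) k A (f : V -> W) :
  open A -> (forall x, A x -> differentiable f x) ->
  (forall v, exists2 h, Ck_on k A h & forall x, A x -> 'd f x v = h x) ->
  Ck_on k.+1 A f.
Proof.
move=> oA df Df; split=> // v; have [h hA fh] := Df v.
by apply: Ck_on_eq hA => // x Ax; rewrite deriveE -?fh//; exact: df.
Qed.

Lemma Ck_on_pred (W : normedModType R) k A (f : V -> W) :
  Ck_on k.+1 A f -> Ck_on k A f.
Proof.
elim: k f => [|k IH] f; first by case=> df _ x /df; exact: differentiable_continuous.
by move=> [df Df]; split=> // v; apply: IH; exact: Df.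
Qed.

Lemma Ck_on_cst (W : normedModType R) k A (a : W) : Ck_on k A (fun=> a).
Proof.
elim: k a => [|k IH] a /=; first by move=> x _; exact: cst_continuous.
split=> [x _|v]; first exact: differentiable_cst.
have -> : 'D_v (fun=> a) = (fun=> 0) :> (V -> W).
  by apply/funext => x; exact: derive_cst.
exact: IH.
Qed.

Lemma Ck_on_id k A : Ck_on k A (id : V -> V).
Proof.
case: k => [|k]; first by move=> x _; exact: cvg_id.
split=> [x _|v]; first exact: ex_diff.
have -> : 'D_v id = (fun=> v) :> (V -> V) by apply/funext => x; exact: derive_id.
exact: Ck_on_cst.
Qed.

Lemma Ck_on_add (W : normedModType R) k A (f g : V -> W) : open A ->
  Ck_on k A f -> Ck_on k A g -> Ck_on k A (f + g).
Proof.
move=> oA; elim: k f g => [|k IH] f g.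
  by move=> fA gA x Ax; exact: (cvgD (fA x Ax) (gA x Ax)).
move=> [df Df] [dg Dg]; apply: Ck_onS => // [x Ax|v].
  by apply: differentiableD; [exact: df|exact: dg].
exists ('D_v f + 'D_v g) => [|x Ax]; first by apply: IH; [exact: Df|exact: Dg].
by have [dfx dgx] := (df x Ax, dg x Ax); rewrite diffD// !fctE !deriveE.
Qed.

Lemma Ck_on_sum (W : normedModType R) k A I (s : seq I) (F : I -> V -> W) :
  open A -> (forall i, Ck_on k A (F i)) ->
  Ck_on k A (fun x => \sum_(i <- s) F i x).
Proof.
move=> oA FA; elim: s => [|i s IH].
  rewrite (_ : (fun _ => _) = (fun=> 0)); first exact: Ck_on_cst.
  by apply/funext => x; rewrite big_nil.
rewrite (_ : (fun _ => _) = F i + (fun x => \sum_(j <- s) F j x)).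
  exact: Ck_on_add.
by apply/funext => x; rewrite big_cons.
Qed.

Lemma Ck_on_mul k A (f g : V -> R) : open A ->
  Ck_on k A f -> Ck_on k A g -> Ck_on k A (f * g).
Proof.
move=> oA; elim: k f g => [|k IH] f g.
  by move=> fA gA x Ax; exact: (cvgM (fA x Ax) (gA x Ax)).
move=> fA gA; have [[df Df] [dg Dg]] := (fA, gA).
apply: Ck_onS => // [x Ax|v].
  by apply: differentiableM; [exact: df|exact: dg].
exists (f * 'D_v g + g * 'D_v f) => [|x Ax].
  by apply: Ck_on_add => //; apply: IH; first [exact: Df|exact: Dg|exact: Ck_on_pred].
by have [dfx dgx] := (df x Ax, dg x Ax); rewrite diffM// !fctE !deriveE.
Qed.

Lemma Ck_on_scalel (W : normedModType R) k A (f : V -> R) (w : W) : open A ->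
  Ck_on k A f -> Ck_on k A (fun x => f x *: w).
Proof.
move=> oA; elim: k f => [|k IH] f.
  by move=> fA x Ax; exact: (@continuousZr_tmp _ _ _ f w x (fA x Ax)).
move=> [df Df]; apply: Ck_onS => // [x Ax|v].
  by apply: differentiableZl; exact: df.
exists (fun x => 'D_v f x *: w) => [|x Ax]; first exact: IH (Df v).
by have dfx := df x Ax; rewrite diffZl// deriveE.
Qed.

Lemma Ck_on_lin (W W' : normedModType R) k A (L : {linear W -> W'}) (f : V -> W) :
  continuous L -> open A -> Ck_on k A f -> Ck_on k A (L \o f).
Proof.
move=> cL oA; elim: k f => [|k IH] f.
  by move=> fA x Ax; exact: (continuous_comp (fA x Ax) (cL (f x))).
move=> [df Df]; have dL y : differentiable L y by exact: linear_differentiable.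
apply: Ck_onS => // [x Ax|v].
  by apply: differentiable_comp => //; exact: df.
exists (L \o 'D_v f) => [|x Ax]; first exact: IH (Df v).
by have dfx := df x Ax; rewrite diff_comp// diff_lin//= deriveE.
Qed.

End CkTheory.

Section CkComp.
Context {R : realType}.

Lemma linear_coord n (i : 'I_n) : linear (fun x : 'rV[R]_n => x 0 i : R).
Proof. by move=> a x y; rewrite !mxE. Qed.

Lemma Ck_on_coord m n k (A : set 'rV[R]_n) (f : 'rV[R]_n -> 'rV[R]_m) i :
  open A -> Ck_on k A f -> Ck_on k A (fun x => f x 0 i : R).
Proof.
move=> oA fA.
pose LM := GRing.isLinear.Build _ _ _ _ _ (@linear_coord m i).
pose L : {linear 'rV[R]_m -> R} := HB.pack (fun x : 'rV[R]_m => x 0 i : R) LM.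
have -> : (fun x => f x 0 i) = L \o f by [].
by apply: Ck_on_lin => // x; exact: coord_continuous.
Qed.

Lemma Ck_on_rV m n k (A : set 'rV[R]_n) (f : 'rV[R]_n -> 'rV[R]_m) :
  open A -> (forall i, Ck_on k A (fun x => f x 0 i : R)) -> Ck_on k A f.
Proof.
move=> oA fA.
have -> : f = (fun x => \sum_i f x 0 i *: delta_mx 0 i).
  by apply/funext => x; rewrite -row_sum_delta.
by apply: Ck_on_sum => // i; exact: Ck_on_scalel.
Qed.

(** By the chain rule in coordinates, the derivative of [F \o T] along [v] is the
    sum over i of the products of the i-th component of [T]'s derivative with the
    i-th partial derivative of [F] composed with [T]; both factors are C^k. *)
Lemma Ck_on_comp m n k (A : set 'rV[R]_n) (B : set 'rV[R]_m)
    (T : 'rV[R]_n -> 'rV[R]_m) (F : 'rV[R]_m -> R) :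
  open A -> (forall x, A x -> B (T x)) ->
  Ck_on k A T -> Ck_on k B F -> Ck_on k A (F \o T).
Proof.
move=> oA AB; elim: k F => [|k IH] F.
  by move=> TA FB x Ax; exact: (continuous_comp (TA x Ax) (FB _ (AB x Ax))).
move=> TA [dF DF]; have [dT DT] := TA.
have dTx x : A x -> differentiable T x by exact: dT.
have dFx x : A x -> differentiable F (T x) by move=> /AB; exact: dF.
apply: Ck_onS => // [x Ax|v].
  by apply: differentiable_comp; [exact: dTx|exact: dFx].
exists (fun x => \sum_i ((fun x => 'D_v T x 0 i) *
                         ('D_(delta_mx 0 i) F \o T)) x) => [|x Ax].
  apply: Ck_on_sum => // i; apply: Ck_on_mul => //.
    by apply: Ck_on_coord => //; exact: DT.
  by apply: IH; [exact: Ck_on_pred|exact: DF].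
have [dTx' dFx'] := (dTx x Ax, dFx x Ax).
rewrite diff_comp//= [X in 'd F (T x) X]row_sum_delta linear_sum.
apply: eq_bigr => i _.
by rewrite linearZ /= fctE /= (deriveE v dTx') (deriveE _ dFx').
Qed.

End CkComp.

(** * Bump functions *)

Section Bump.
Context {R : realType}.

(** The classical function exp(- 1 / t), flat at 0, with the weights t^-j: the
    family is closed under differentiation up to linear combinations, so that one
    induction proves all its members smooth. *)
Definition flat_exp (j : nat) (t : R) : R :=
  if 0 < t then t^-1 ^+ j * expR (- t^-1) else 0.

Lemma flat_exp_le0 j t : t <= 0 -> flat_exp j t = 0.
Proof. by rewrite /flat_exp leNgt => /negPf->. Qed.

Lemma flat_exp_gt0 j t : 0 < t -> 0 < flat_exp j t.
Proof. by move=> t0; rewrite /flat_exp t0 mulr_gt0 ?expR_gt0// exprn_gt0// invr_gt0. Qed.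

Lemma flat_exp_ge0 j t : 0 <= flat_exp j t.
Proof.
by have [/(flat_exp_gt0 j)/ltW//|/(flat_exp_le0 j)->] := ltP 0 t.
Qed.

(** The exponential dominates the term of degree [j.+2] of its series at 1 / t. *)
Lemma flat_exp_le_sqr j t : flat_exp j t <= (j.+2)`!%:R * t ^+ 2.
Proof.
have [t0|/(flat_exp_le0 j)->] := ltP 0 t; last first.
  by rewrite mulr_ge0// sqr_ge0.
rewrite /flat_exp t0 expRN.
have u0 : 0 < t^-1 by rewrite invr_gt0.
have F0 : 0 < (j.+2)`!%:R :> R by rewrite ltr0n fact_gt0.
have := expR_ge1Dxn j.+1 (ltW u0); set E := expR _ => hE.
have {}hE : t^-1 ^+ j.+2 / (j.+2)`!%:R <= E by apply: le_trans hE; rewrite lerDr.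
rewrite ler_pdivrMr ?expR_gt0//.
apply: le_trans (ler_wpM2l _ hE); last by rewrite mulr_ge0// ?sqr_ge0// ltW.
rewrite le_eqVlt; apply/orP; left; apply/eqP.
have -> : t^-1 ^+ j.+2 = t^-1 ^+ j * t^-1 ^+ 2 by rewrite -exprD addn2.
move: F0; set a := t^-1 ^+ j; move: (_%:R) => F F0.
have tn0 : t != 0 by rewrite gt_eqF.
have Fn0 : F != 0 by rewrite gt_eqF.
by field; rewrite Fn0.
Qed.

(** At 0 the quadratic bound makes the difference quotient tend to 0. *)
Lemma is_derive_flat_exp j t : is_derive t (1 : R) (flat_exp j)
  (flat_exp j.+2 t - j%:R * flat_exp j.+1 t).
Proof.
have [t0|t0|->] := ltgtP t 0.
- rewrite !flat_exp_le0 ?ltW// mulr0 subr0.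
  apply: (@near_eq_is_derive R R R (cst 0)).
  have := lt_nbhsl t0; apply: filterS => y y0.
  by rewrite flat_exp_le0// ltW.
- have nearE : \forall y \near t, y^-1 ^+ j * expR (- y^-1) = flat_exp j y.
    by have := lt_nbhsr t0; apply: filterS => y y0; rewrite /flat_exp y0.
  have tn0 : t != 0 by rewrite gt_eqF.
  have dV : is_derive t (1:R) (fun y : R => y^-1) (- t ^- 2 *: 1).
    exact: (@is_deriveV _ id).
  have dE : is_derive t (1:R) (expR \o (- (fun y : R => y^-1)))
      (expR (- t^-1) * - (- t ^- 2 *: 1)).
    exact: is_derive1_comp.
  apply: (near_eq_is_derive nearE).
  rewrite (_ : (fun _ => _) =
    (fun y : R => y^-1) ^+ j * (expR \o (- (fun y : R => y^-1)))); last first.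
    by apply/funext => y; rewrite !fctE.
  apply: is_derive_eq.
  rewrite /flat_exp t0 !fctE /= /GRing.scale /= !mulr1.
  case: j {nearE} => [|j] /=.
    by rewrite !mul0r ?expr0 !mul1r mulr0 addr0 subr0 opprK mulrC exprVn.
  by set E := expR _; rewrite -exprVn !exprS; ring.
- rewrite !flat_exp_le0// mulr0 subr0.
  have lim0 : h^-1 *: (flat_exp j (h *: 1 + 0) - flat_exp j 0) @[h --> 0^'] --> (0 : R).
    pose C : R := (j.+2)`!%:R.
    have C0 : 0 < C by rewrite ltr0n fact_gt0.
    apply/cvgrPdist_le => e e0; near=> h.
    have h0 : h != 0 by near: h; exact: nbhs_dnbhs_neq.
    have he : `|h| < e / C by near: h; apply: dnbhs0_lt; rewrite divr_gt0.
    rewrite sub0r normrN addr0 [flat_exp j 0]flat_exp_le0// subr0 /GRing.scale /= mulr1.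
    rewrite normrM normfV ler_pdivrMl ?normr_gt0// ger0_norm ?flat_exp_ge0//.
    apply: le_trans (flat_exp_le_sqr j h) _.
    rewrite -/C -real_normK ?num_real// expr2 mulrCA.
    by rewrite ler_wpM2l// mulrC -ler_pdivlMr// ltW.
  split; first by apply/cvg_ex; exists 0.
  exact: cvg_lim lim0.
Unshelve. all: by end_near. Qed.

Lemma Ck_on_flat_exp n k j (A : set 'rV[R]_n) (s : 'rV[R]_n -> R) :
  open A -> smooth_on A s -> Ck_on k A (flat_exp j \o s).
Proof.
move=> oA sA.
have dE i t : differentiable (flat_exp i) t.
  apply/derivable1_diffP; exact: (@ex_derive _ _ _ _ _ _ _ (is_derive_flat_exp i t)).
have ds x : A x -> differentiable s x by have [/= + _] := sA 1%N; exact.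
elim: k j => [|k IH] j.
  move=> x Ax; apply: differentiable_continuous.
  by apply: differentiable_comp; [exact: ds|exact: dE].
apply: Ck_onS => // [x Ax|v].
  by apply: differentiable_comp; [exact: ds|exact: dE].
exists ('D_v s * (flat_exp j.+2 \o s + (- j%:R : R) *: (flat_exp j.+1 \o s))) => [|x Ax].
  apply: Ck_on_mul => //; first by have [_] := sA k.+1; exact.
  apply: Ck_on_add => //.
  rewrite (_ : _ *: _ = (fun=> - j%:R) * (flat_exp j.+1 \o s)) //.
  by apply: Ck_on_mul => //; exact: Ck_on_cst.
have dsx := ds x Ax.
rewrite diff_comp//= -(deriveE v dsx) diff1E// derive1E.
rewrite (@derive_val _ _ _ _ _ _ _ (is_derive_flat_exp j (s x))).
by rewrite !fctE /= !scaleNr.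
Qed.

(** The argument r^2 - |x - x0|^2 of [flat_exp] uses the Euclidean norm, which is
    smooth and at least the sup norm, in which the support is measured. *)
Lemma exists_bump n (x0 : 'rV[R]_n) (r : R) : 0 < r ->
  exists phi : 'rV[R]_n -> R, [/\ smooth_on setT phi, phi x0 != 0 &
    forall x, r <= `|x - x0| -> phi x = 0].
Proof.
move=> r0.
pose s (x : 'rV[R]_n) : R := r ^+ 2 + \sum_i (- 1 * ((x 0 i - x0 0 i) * (x 0 i - x0 0 i))).
exists (flat_exp 0 \o s); split => [k||x rx].
- apply: Ck_on_flat_exp => [|{}k]; first exact: openT.
  have coordS i : Ck_on k setT (fun x : 'rV[R]_n => x 0 i - x0 0 i).
    apply: Ck_on_add; [exact: openT| |exact: Ck_on_cst].
    apply: (@Ck_on_coord _ _ _ _ _ id); [exact: openT|exact: Ck_on_id].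
  apply: Ck_on_add; [exact: openT|exact: Ck_on_cst|].
  apply: Ck_on_sum; first exact: openT.
  move=> i; apply: Ck_on_mul; [exact: openT|exact: Ck_on_cst|].
  by apply: Ck_on_mul => //; exact: openT.
- rewrite gt_eqF//= flat_exp_gt0// /s big1 ?addr0 ?exprn_gt0//.
  by move=> i _; rewrite subrr mul0r mulr0.
- apply: flat_exp_le0; rewrite /s.
  have [i ri] : exists i, r <= `|x 0 i - x0 0 i|.
    apply/existsP; apply: contraLR rx; rewrite negb_exists -ltNge => /forallP xr.
    rewrite /Num.norm /= mx_normrE; apply/bigmax_ltP; split=> // -[a i] _ /=.
    by rewrite (ord1 a) !mxE ltNge xr.
  rewrite -lerBrDl sub0r (bigD1 i)//= -[leRHS]addr0 lerD//.
    by rewrite mulN1r lerN2 -expr2 -[leRHS]real_normK ?num_real// ler_pXn2r ?nnegrE// ltW.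
  by apply: sumr_le0 => l _; rewrite mulN1r oppr_le0 -expr2 sqr_ge0.
Qed.

End Bump.

(** * Charts and their transition matrices *)

(* The unqualified name denotes the coordinates in a basis of a vector space. *)
Local Notation coord := Defs.coord.

Section Charts.
Context {R : realType} {n : nat} {M : manifold R n}.
Implicit Types (c d e : chart R n M) (p q : M).

Lemma coord_inv_dom c x : (coord c @` dom c) x -> dom c (coord_inv c x).
Proof. by move=> [p cp <-]; rewrite coordK. Qed.

Lemma coord_invK c x : (coord c @` dom c) x -> coord c (coord_inv c x) = x.
Proof. by move=> [p cp <-]; rewrite coordK. Qed.

Lemma open_codom_preimage c (U : set M) :
  open U -> open (coord c @` dom c `&` coord_inv c @^-1` U).
Proof.
move=> oU; rewrite openE => x [cx Ux]; apply: filterI.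
  by apply: open_nbhs_nbhs; split=> //; exact: codom_open.
exact: (coord_inv_continuous cx (open_nbhs_nbhs (conj oU Ux))).
Qed.

Lemma overlapE c (U : set M) :
  coord c @` (dom c `&` U) = coord c @` dom c `&` coord_inv c @^-1` U.
Proof.
apply/seteqP; split=> [_ [p [cp Up] <-]|_ [[p cp <-]]] /=.
  by split; [exists p|rewrite /= coordK].
by rewrite coordK// => Up; exists p.
Qed.

Lemma open_overlap c d : open (coord c @` (dom c `&` dom d)).
Proof. by rewrite overlapE; apply: open_codom_preimage; exact: dom_open. Qed.

Lemma differentiable_transition c d p : atlas c -> atlas d ->
  dom c p -> dom d p -> differentiable (coord d \o coord_inv c) (coord c p).
Proof.
move=> ac ad cp dp; have [/= + _] := atlas_compatible ac ad 1%N.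
by apply; exists p.
Qed.

Lemma transition_id c p : dom c p -> transition c c p = 1%:M.
Proof.
move=> cp.
have cid : \forall x \near coord c p, id x = (coord c \o coord_inv c) x.
  apply: filterS (open_nbhs_nbhs (conj (codom_open (c:=c)) _)); last by exists p.
  by move=> x cx /=; rewrite coord_invK.
have dc : differentiable (coord c \o coord_inv c) (coord c p).
  exact: near_eq_differentiable cid _.
apply/row_matrixP => i; rewrite !rowE -deriveEjacobian// mulmx1.
by rewrite -(near_eq_derive _ cid) derive_id.
Qed.

(** Chain rule for the changes of coordinates; vectors are rows, whence the order
    of the factors. *)
Lemma transition_comp c d e p : atlas c -> atlas d -> atlas e ->
  dom c p -> dom d p -> dom e p ->
  transition c d p *m transition d e p = transition c e p.
Proof.
move=> ac ad ae cp dp ep.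
have [dcd dde dce] := And3 (differentiable_transition ac ad cp dp)
  (differentiable_transition ad ae dp ep) (differentiable_transition ac ae cp ep).
have cN : nbhs (coord c p) (coord c @` (dom c `&` dom d)).
  by apply: open_nbhs_nbhs; split; [exact: open_overlap|exists p].
have cE : \forall x \near coord c p,
    ((coord e \o coord_inv d) \o (coord d \o coord_inv c)) x
    = (coord e \o coord_inv c) x.
  apply: filterS cN.
  by move=> _ [q [cq dq] <-] /=; rewrite coordK// coordK.
have pE : (coord d \o coord_inv c) (coord c p) = coord d p by rewrite /= coordK.
have dde' : differentiable (coord e \o coord_inv d)
    ((coord d \o coord_inv c) (coord c p)) by rewrite pE.
have t1 v : v *m transition c d p =
    'D_v (coord d \o coord_inv c) (coord c p) := esym (deriveEjacobian v dcd).
have t2 v : v *m transition d e p =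
    'D_v (coord e \o coord_inv d) (coord d p) := esym (deriveEjacobian v dde).
have t3 v : v *m transition c e p =
    'D_v (coord e \o coord_inv c) (coord c p) := esym (deriveEjacobian v dce).
(* From here on only the action of the three matrices on row vectors matters. *)
move: (transition c d p) (transition d e p) (transition c e p) t1 t2 t3.
move=> T1 T2 T3 t1 t2 t3; apply/row_matrixP => i.
rewrite !rowE mulmxA t1 t2 t3 -(near_eq_derive _ cE).
by rewrite (derive_comp _ dcd dde') pE.
Qed.

End Charts.

(** * Extending a tangent vector to a smooth field *)

Section Extension.
Context {R : realType} {n : nat} {M : manifold R n}.
Implicit Types (c d : chart R n M) (p q : M).

Definition bump_field (c : chart R n M) (phi : 'rV[R]_n -> R) (w : 'rV[R]_n) : field M :=
  fun q => if `[< dom c q >] then phi (coord c q) *: (w *m transition c (chart_at q) q)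
           else 0.

(** In the chart [d] the factors [transition] of the definition combine into a
    single Jacobian, that is, a directional derivative of the change of
    coordinates, whose smoothness is part of the compatibility of the atlas. *)
Lemma bump_field_in c d phi w q : atlas c -> atlas d -> dom c q -> dom d q ->
  field_in d (bump_field c phi w) q
  = phi (coord c q) *: 'D_w (coord d \o coord_inv c) (coord c q).
Proof.
move=> ac ad cq dq; rewrite /field_in /bump_field asboolT// -scalemxAl -mulmxA.
rewrite transition_comp//; [|exact: chart_at_atlas|exact: chart_at_dom].
by rewrite deriveEjacobian//; exact: differentiable_transition.
Qed.

(** Every point has a neighbourhood which lies in the domain of [c] or on which the
    field vanishes: the image of [K] in the manifold is compact, hence closed, so
    that a point outside the domain of [c] has a neighbourhood disjoint from it. *)
Lemma smooth_bump_field c phi w (K : set 'rV[R]_n) : atlas c ->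
  smooth_on setT phi -> compact K -> K `<=` coord c @` dom c ->
  (forall x, ~ K x -> phi x = 0) -> smooth_field (bump_field c phi w).
Proof.
move=> ac sphi cK Kc phi0 d ad k.
have clK : closed (coord_inv c @` K).
  apply: compact_closed; first exact: manifold_hausdorff.
  apply: continuous_compact => //.
  apply: continuous_in_subspaceT => x /set_mem /Kc; exact: coord_inv_continuous.
apply: Ck_on_cover => y dy; have [cy|cy] := pselect (dom c (coord_inv d y)).
  exists (coord d @` (dom d `&` dom c)); first by rewrite overlapE.
  apply: (@Ck_on_eq _ _ _ _ _ (fun z => (phi \o (coord c \o coord_inv d)) z *:
     ('D_w (coord d \o coord_inv c) \o (coord c \o coord_inv d)) z)).
  - exact: open_overlap.
  - by move=> _ [q [dq cq] <-] /=; rewrite coordK// bump_field_in.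
  set T := coord c \o coord_inv d; set G := 'D_w _.
  have oA : open (coord d @` (dom d `&` dom c)) by exact: open_overlap.
  have TA : Ck_on k (coord d @` (dom d `&` dom c)) T by exact: atlas_compatible.
  apply: Ck_on_rV => // i.
  rewrite (_ : (fun _ => _) = (phi \o T) * ((fun x => G x 0 i) \o T)); last first.
    by apply/funext => z; rewrite mxE.
  apply: Ck_on_mul => //.
    by apply: (@Ck_on_comp _ _ _ _ _ setT) => //; exact: sphi.
  apply: (@Ck_on_comp _ _ _ _ _ (coord c @` (dom c `&` dom d))) => //.
    by move=> _ [q [dq cq] <-]; exists q; rewrite // /T /= coordK.
  apply: Ck_on_coord; first exact: open_overlap.
  by have [_] := atlas_compatible ac ad k.+1; exact.
exists (coord d @` dom d `&` coord_inv d @^-1` ~` (coord_inv c @` K)).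
  split=> // -[x Kx xE]; apply: cy; rewrite -xE; exact/coord_inv_dom/Kc.
apply: (@Ck_on_eq _ _ _ _ _ (fun=> 0)); last exact: Ck_on_cst.
  exact/open_codom_preimage/closed_openC.
move=> z [dz Kz] /=; rewrite /field_in /bump_field; case: asboolP => [cz|_];
  last by rewrite mul0mx.
rewrite phi0 ?scale0r ?mul0mx// => Kz'; apply: Kz.
by exists (coord c (coord_inv d z)); rewrite // coordK.
Qed.

(** The bump function need not be 1 at the centre, only nonzero there, so the
    constant field is rescaled. *)
Lemma exists_smooth_field p v : exists2 Y : field M, smooth_field Y & Y p = v.
Proof.
set c := chart_at p.
have cp : dom c p := chart_at_dom p.
have ac : atlas c := chart_at_atlas p.
have : nbhs (coord c p) (coord c @` dom c).
  by apply: open_nbhs_nbhs; split; [exact: codom_open|exists p].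
move=> /nbhs_ballP[r /= r0 rc].
have r20 : 0 < r / 2 by rewrite divr_gt0.
have [phi [sphi phip phi0]] := exists_bump (coord c p) r20.
exists (bump_field c phi ((phi (coord c p))^-1 *: v)).
  apply: (@smooth_bump_field _ _ _ (closed_ball (coord c p) (r / 2))) => //.
  - apply: bounded_closed_compact; last exact: closed_ball_closed.
    exists (`|coord c p| + r / 2); split; first exact: num_real.
    move=> N /ltW rN x; rewrite closed_ballE// /closed_ball_ /= => xr.
    apply: le_trans rN; rewrite -[x in leLHS](subKr (coord c p)).
    by apply: le_trans (ler_normB _ _) _; rewrite lerD2l.
  - by apply: subset_trans rc; exact: subset_closure_half.
  - move=> x; rewrite closed_ballE// /closed_ball_ /= distrC => /negP.
    by rewrite -ltNge => /ltW; exact: phi0.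
by rewrite /bump_field asboolT// transition_id// mulmx1 scalerA divff// scale1r.
Qed.

End Extension.

(** * The covariant derivative of the generator *)

Section Inner.
Context {R : realType} {n : nat} {M : manifold R n} {g : metric M}.
Implicit Types X Y Z : field M.

Lemma pairing_flat X Y p : pairing (flat g X) Y p = inner g Y X p.
Proof. by rewrite /pairing /flat /inner mulmxA. Qed.

Lemma innerC X Y p : pseudo_riemannian g -> inner g X Y p = inner g Y X p.
Proof.
case=> gT _ _; rewrite /inner -[in LHS](trmxK (X p)) -{1}(gT p) -!trmx_mul.
by rewrite [LHS]mxE mulmxA.
Qed.

(** The values at [p] of the smooth fields fill the tangent space
    ([exists_smooth_field]), so this is the invertibility of the Gram matrix. *)
Lemma inner_eq0 Z p : pseudo_riemannian g ->
  (forall Y, smooth_field Y -> inner g Z Y p = 0) -> Z p = 0.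
Proof.
case=> _ gU _ Z0; suff Zg : Z p *m g p = 0.
  by rewrite -[Z p](mulmxK (gU p)) Zg mul0mx.
apply/rowP => i; rewrite [RHS]mxE.
have [Y sY Yp] := exists_smooth_field p (delta_mx 0 i).
by have := Z0 Y sY; rewrite /inner Yp trmx_delta -colE mxE.
Qed.

End Inner.

(** Metricity turns the covariant derivative of the dual form of [P] into the inner
    product of [Y] and [D X P]; the products of [inner g X P] and [inner g Y P]
    then cancel. *)
Lemma inner_semi_symmetric (R : realType) n (M : manifold R n) (g : metric M)
    (D : connection M) (P : field M) (omega : M -> R) :
  pseudo_riemannian g -> metric_connection g D -> smooth_field P ->
  concircular g D P omega ->
  forall X Y, smooth_field X -> smooth_field Y -> forall p,
  inner g (semi_symmetric g D P X P) Y p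
  = (omega p + inner g P P p) * inner g X Y p.
Proof.
move=> gpr gD sP conc X Y sX sY p.
have := conc X Y sX sY p; rewrite /cov_derive !pairing_flat.
have -> : pairing (flat g P) Y = inner g Y P.
  by apply/funext => q; rewrite pairing_flat.
rewrite gD// [_ + inner g Y (D X P) p]addrC addrK => /eqP.
rewrite subr_eq => /eqP; rewrite innerC// => DXP.
rewrite {1}/inner /semi_symmetric pairing_flat !mulmxDl !mulNmx -!scalemxAl.
have entryE (A B C : 'M[R]_1) a b :
    (A + a *: B - b *: C) 0 0 = A 0 0 + a * B 0 0 - b * C 0 0.
  by rewrite !mxE.
by rewrite entryE -!/(inner g _ _ p) DXP (innerC Y P)//; ring.
Qed.

Theorem theorem2p2 (R : realType) (n : nat) (n_gt2 : (2 < n)%N)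
    (M : manifold R n) (g : metric M) (g_pr : pseudo_riemannian g)
    (nabla : connection M) (nabla_lc : levi_civita g nabla)
    (P : field M) (P_smooth : smooth_field P) (omega : M -> R)
    (nabla1_concircular : concircular g nabla P omega) :
  P_connection (semi_symmetric g nabla P) P
  <-> (forall p : M, omega p = - inner g P P p).
Proof.
case: nabla_lc => _ _ gD.
have D1 := inner_semi_symmetric g_pr gD P_smooth nabla1_concircular.
split=> [D1P0 p|omegaE X sX p]; last first.
  apply: (inner_eq0 (g := g)) => // Y sY.
  by rewrite D1// omegaE addNr mul0r.
have n0 : (0 < n)%N by apply: leq_trans n_gt2.
have [X sX Xp] := exists_smooth_field p (delta_mx 0 (Ordinal n0) : 'rV[R]_n).
apply/eqP; rewrite -addr_eq0; apply: contraT => omegaN.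
have /rowP/(_ (Ordinal n0)) : X p = 0.
  apply: (inner_eq0 (g := g)) => // Y sY; apply: (mulfI omegaN).
  by rewrite -D1// mulr0 /inner D1P0// !mul0mx mxE.
by rewrite Xp !mxE !eqxx => /eqP; rewrite oner_eq0.
Qed.
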